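(* Let $G$ be a finite group, $K\le G$ a subgroup, $(\sigma,W)$ a representation of $G$ of dimension $d_\sigma$ and $(\theta,V)$ a representation of $K$ of dimension $d_\theta$. Let $m=\dim\mathrm{Hom}_G(W,\mathrm{Ind}_K^GV)$ and suppose that $L_1,L_2,\ldots,L_m\in\mathrm{Hom}_K(V,\mathrm{Res}^G_KW)$. Then the following facts are equivalent: (1) the set $\{L_1,L_2,\ldots,L_m\}$ is an orthonormal basis of $\mathrm{Hom}_K(V,\mathrm{Res}^G_KW)$; (2) the set $\{\sqrt{|G/K|}\,L_1^\diamond,\ldots,\sqrt{|G/K|}\,L_m^\diamond\}$ is an orthonormal basis of $\mathrm{Hom}_G(\mathrm{Ind}_K^GV,W)$; (3) the set $\left\{\sqrt{\tfrac{d_\sigma}{d_\theta}}\,L_1^*,\ldots,\sqrt{\tfrac{d_\sigma}{d_\theta}}\,L_m^*\right\}$ is an orthonormal basis of $\mathrm{Hom}_K(\mathrm{Res}^G_KW,V)$; (4) the set $\left\{\sqrt{\tfrac{d_\sigma}{d_\theta}}\,(L_1^* )^\vee,\ldots,\sqrt{\tfrac{d_\sigma}{d_\theta}}\,(L_m^* )^\vee\right\}$ is an orthonormal basis of $\mathrm{Hom}_G(W,\mathrm{Ind}_K^GV)$.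
   Context: All vector spaces are finite-dimensional complex vector spaces with a Hermitian scalar product (linear in the first argument); all representations of finite groups are unitary. $T^*$ denotes the adjoint of $T$. For spaces $A,B$, $\mathrm{Hom}(A,B)$ (and every subspace of it) carries the normalized Hilbert–Schmidt scalar product $\langle T_1,T_2\rangle=\frac{1}{\dim A}\mathrm{tr}(T_2^*T_1)$. $\mathrm{Hom}_G(A,B)$ (resp. $\mathrm{Hom}_K$) is the space of linear maps intertwining the $G$- (resp. $K$-) actions. Induced representation: $\mathrm{Ind}_K^GV=\{f:G\to V: f(gk)=\theta(k^{-1})f(g)\ \forall g\in G,k\in K\}$ with $G$-action $[\lambda(g_0)f](g)=f(g_0^{-1}g)$ and scalar product $\langle f_1,f_2\rangle=\frac1{|K|}\sum_{g\in G}\langle f_1(g),f_2(g)\rangle_V$. Maps: for $L\in\mathrm{Hom}_K(\mathrm{Res}^G_KW,V)$, $L^\vee\in\mathrm{Hom}_G(W,\mathrm{Ind}_K^GV)$ is $[L^\vee w](g)=\frac{1}{\sqrt{|G/K|}}L\sigma(g^{-1})w$. For $L\in\mathrm{Hom}_K(V,\mathrm{Res}^G_KW)$, $L^\diamond\in\mathrm{Hom}_G(\mathrm{Ind}_K^GV,W)$ is $L^\diamond f=\frac{1}{\sqrt{|G||K|}}\sum_{g\in G}\sigma(g)Lf(g)$. *)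

(* Defs.v *)
From HB Require Import structures.
From mathcomp Require Import all_boot all_order all_algebra all_fingroup.
From mathcomp Require Import complex.
From mathcomp Require Import boolp classical_sets reals.

Set Implicit Arguments.
Unset Strict Implicit.
Unset Printing Implicit Defensive.

Import Order.TTheory GRing.Theory Num.Theory Num.Def.
Local Open Scope ring_scope.

Section HermitianSpaces.
Variable C : numClosedFieldType.

Lemma dotC (A : vectType C) (f : {dot A for conjC}) (u v : A) :
  f u v = (f v u)^*.
Proof. by rewrite [LHS]hermC mul1r. Qed.

Lemma dot_suml (A : vectType C) (f : {dot A for conjC}) I (r : seq I) P
    (F : I -> A) v :
  f (\sum_(i <- r | P i) F i) v = \sum_(i <- r | P i) f (F i) v.
Proof. exact: linear_sumlz. Qed.

Lemma dot_sumr (A : vectType C) (f : {dot A for conjC}) I (r : seq I) P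
    (F : I -> A) v :
  f v (\sum_(i <- r | P i) F i) = \sum_(i <- r | P i) f v (F i).
Proof. exact: linear_sumr. Qed.

Lemma dotZl (A : vectType C) (f : {dot A for conjC}) a u v :
  f (a *: u) v = a * f u v.
Proof. exact: linearZl_LR. Qed.

Lemma dotZr (A : vectType C) (f : {dot A for conjC}) a u v :
  f v (a *: u) = a^* * f v u.
Proof. exact: linearZr_LR. Qed.

Lemma dotDl (A : vectType C) (f : {dot A for conjC}) u v w :
  f (u + v) w = f u w + f v w.
Proof. exact: linearDl. Qed.

Lemma dotDr (A : vectType C) (f : {dot A for conjC}) u v w :
  f w (u + v) = f w u + f w v.
Proof. exact: linearDr. Qed.

Lemma dotBl (A : vectType C) (f : {dot A for conjC}) u v w :
  f (u - v) w = f u w - f v w.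
Proof. exact: linearBl. Qed.

Lemma dotBr (A : vectType C) (f : {dot A for conjC}) u v w :
  f w (u - v) = f w u - f w v.
Proof. exact: linearBr. Qed.

Lemma dot_injr (A : vectType C) (f : {dot A for conjC}) (u v : A) :
  (forall w, f w u = f w v) -> u = v.
Proof.
move=> H; apply/eqP; rewrite -subr_eq0 -(dnorm_eq0 f).
by rewrite dotBr H subrr.
Qed.

Lemma dot_injl (A : vectType C) (f : {dot A for conjC}) (u v : A) :
  (forall w, f u w = f v w) -> u = v.
Proof. by move=> H; apply: (dot_injr (f := f)) => w; rewrite dotC H -dotC. Qed.

Lemma Gram_Schmidt (A : vectType C) (f : {dot A for conjC}) (X : seq A) :
  exists s : seq A, <<s>>%VS = <<X>>%VS /\ orthonormal f s.
Proof.
elim: X => [|x X [s [sX os]]]; first by exists [::].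
have /orthonormalP[us onS] := os.
pose p := \sum_(v <- s) f x v *: v; pose y := x - p.
have pX : p \in <<X>>%VS.
  rewrite -sX /p big_seq; apply: memv_suml => v vs.
  by rewrite memvZ // memv_span.
have spanE : <<x :: X>>%VS = (<[y]> + <<X>>)%VS.
  rewrite span_cons; apply/eqP; rewrite eqEsubv !subv_add !addvSr !andbT.
  rewrite -!memvE; apply/andP; split.
    rewrite -(subrK p x); apply: memv_add => //; exact: memv_line.
  rewrite memvB //; first by rewrite (subvP (addvSl _ _)) // memv_line.
  by rewrite (subvP (addvSr _ _)).
have yo v : v \in s -> f y v = 0.
  move=> vs; rewrite dotBl dot_suml (bigD1_seq v) //= dotZl (onS v v) // eqxx mulr1.
  rewrite big_seq_cond big1 ?addr0 ?subrr // => w /andP[ws wv].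
  by rewrite dotZl (onS w v) // (negPf wv) mulr0.
have [y0|y0] := eqVneq y 0.
  exists s; split=> //; rewrite spanE sX y0.
  have -> : (<[0 : A]> = 0)%VS by apply/eqP; rewrite -subv0 -memvE mem0v.
  by rewrite add0v.
pose c := (sqrtC (f y y))^-1.
have ny : 0 < f y y by rewrite dnorm_gt0.
have c0 : c != 0 by rewrite invr_eq0 sqrtC_eq0 gt_eqF.
have cc : f (c *: y) (c *: y) = 1.
  rewrite dnormZ /c normfV exprVn ger0_norm ?sqrtC_ge0 ?ltW // sqrtCK.
  by rewrite mulVf // gt_eqF.
exists (c *: y :: s); split.
  rewrite span_cons spanE sX; congr (_ + _)%VS.
  apply/eqP; rewrite eqEsubv -!memvE memvZ ?memv_line //=.
  by rewrite -[X in X \in _](scalerK c0) memvZ ?memv_line.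
rewrite -cat1s orthonormal_cat os; apply/and3P; split=> //.
  by rewrite /orthonormal /= cc eqxx.
by apply/(orthoPl (form := f)) => v vs; rewrite dotZl yo ?mulr0.
Qed.

Lemma orthonormal_basis_exists (A : vectType C) (f : {dot A for conjC}) :
  exists e : (\dim {:A}).-tuple A, basis_of {:A} e /\
    forall i j : 'I_(\dim {:A}), f e`_i e`_j = (i == j)%:R.
Proof.
have [s [sX os]] := Gram_Schmidt f (vbasis {:A}).
have bs : basis_of {:A} s.
  by rewrite /basis_of sX (span_basis (vbasisP _)) eqxx (orthonormal_free os).
have sz : size s == \dim {:A}.
  by rewrite -(eqP (orthonormal_free os)) sX (span_basis (vbasisP _)).
exists (Tuple sz); split=> // i j.
have /orthonormalP[us onS] := os.
by rewrite onS ?mem_nth ?(eqP sz) // nth_uniq ?(eqP sz).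
Qed.

Section Adjoint.
Variables (A B : vectType C) (fA : {dot A for conjC}) (fB : {dot B for conjC}).

(* T^* is characterised by <T a, b>_B = <a, T^* b>_A; it is unique because fA is
   positive definite, and adjointP shows that it exists. *)
Definition adjoint (T : 'Hom(A, B)) : 'Hom(B, A) :=
  xget 0 (fun S : 'Hom(B, A) => forall a b, fB (T a) b = fA a (S b)).

Lemma adjointP (T : 'Hom(A, B)) a b : fB (T a) b = fA a (adjoint T b).
Proof.
rewrite /adjoint; case: xgetP => [S _ //|noS]; exfalso.
have [e [be oe]] := orthonormal_basis_exists fA.
pose Sf b0 : A := \sum_(i < \dim {:A}) fB b0 (T e`_i) *: e`_i.
have lin : linear Sf.
  move=> k u v; rewrite scaler_sumr -big_split; apply: eq_bigr => i _ /=.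
  by rewrite dotDl dotZl scalerDl scalerA.
pose L : {linear B -> A} := HB.pack Sf
  (GRing.isSemilinear.Build _ _ _ _ Sf (GRing.semilinear_linear lin)).
apply: (noS (linfun L)) => u v; rewrite lfunE /= /Sf.
rewrite {1}(coord_basis be (memvf u)) linear_sum dot_suml dot_sumr.
apply: eq_bigr => i _; rewrite linearZ dotZl dotZr -dotC mulrC; congr (_ * _).
rewrite {2}(coord_basis be (memvf u)) dot_suml (bigD1 i) //= dotZl oe eqxx.
rewrite big1 ?addr0 ?mulr1 // => j ji.
by rewrite dotZl oe (negPf ji) mulr0.
Qed.

End Adjoint.

(* The trace does not depend on the basis; lftraceE evaluates it in any
   orthonormal one. *)
Definition lftrace (A : vectType C) (T : 'End(A)) : C :=
  \tr (passmx.mxof (vbasis {:A}) (vbasis {:A}) T).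

Lemma lftraceE (A : vectType C) (f : {dot A for conjC}) (e : (\dim {:A}).-tuple A)
    (T : 'End(A)) :
    basis_of {:A} e ->
    (forall i j : 'I_(\dim {:A}), f e`_i e`_j = (i == j)%:R) ->
  lftrace T = \sum_(i < \dim {:A}) f (T e`_i) e`_i.
Proof.
move=> be oe; have bb := vbasisP {:A}; rewrite /lftrace.
have -> : passmx.mxof (vbasis {:A}) (vbasis {:A}) T =
    passmx.mxof (vbasis {:A}) e \1%VF *m
      (passmx.mxof e e T *m passmx.mxof e (vbasis {:A}) \1%VF).
  by rewrite -!passmx.mxof_comp // comp_lfun1l comp_lfun1r.
rewrite mxtrace_mulC -mulmxA -passmx.mxof_comp // comp_lfun1l.
rewrite passmx.mxof1 ?(basis_free be) // mulmx1.
rewrite /mxtrace; apply: eq_bigr => i _.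
rewrite !mxE /= passmx.vecof_delta.
rewrite [X in f X _](coord_basis be (memvf _)) dot_suml (bigD1 i) //= dotZl oe eqxx.
by rewrite big1 ?addr0 ?mulr1 // => j ji; rewrite dotZl oe (negPf ji) mulr0.
Qed.

Section HilbertSchmidt.
Variables (A B : vectType C) (fA : {dot A for conjC}) (fB : {dot B for conjC}).

(* Normalized by the dimension of the source A. Subspaces of 'Hom(A, B) carry
   the restriction of this form. When \dim A = 0 the factor is 0^-1 = 0, which
   is harmless since 'Hom(A, B) is then zero. *)
Definition hs_dot (T1 T2 : 'Hom(A, B)) : C :=
  (\dim {:A})%:R^-1 * lftrace (adjoint fA fB T2 \o T1)%VF.

Lemma hs_dotE (e : (\dim {:A}).-tuple A) (T1 T2 : 'Hom(A, B)) :
    basis_of {:A} e ->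
    (forall i j : 'I_(\dim {:A}), fA e`_i e`_j = (i == j)%:R) ->
  hs_dot T1 T2 =
    (\dim {:A})%:R^-1 * \sum_(i < \dim {:A}) fB (T1 e`_i) (T2 e`_i).
Proof.
move=> be oe; rewrite /hs_dot (lftraceE _ be oe); congr (_ * _).
apply: eq_bigr => i _; rewrite comp_lfunE dotC -adjointP -dotC.
by [].
Qed.

Fact hs_dot_linearl T2 : linear_for *%R (hs_dot^~ T2).
Proof.
have [e [be oe]] := orthonormal_basis_exists fA.
move=> a u v; rewrite !(hs_dotE _ _ be oe) mulrCA -mulrDr; congr (_ * _).
rewrite mulr_sumr -big_split; apply: eq_bigr => i _ /=.
by rewrite add_lfunE scale_lfunE dotDl dotZl.
Qed.

Fact hs_dot_herm T1 T2 : hs_dot T1 T2 = (-1) ^+ false * (hs_dot T2 T1)^*.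
Proof.
have [e [be oe]] := orthonormal_basis_exists fA.
rewrite mul1r !(hs_dotE _ _ be oe) rmorphM rmorph_sum fmorphV rmorph_nat.
by congr (_ * _); apply: eq_bigr => i _; exact: dotC.
Qed.

Fact hs_dot_linearr T1 : linear_for (conjC \; *%R) (hs_dot T1).
Proof.
move=> a u v; rewrite hs_dot_herm hs_dot_linearl.
by rewrite [in RHS]hs_dot_herm [hs_dot T1 v]hs_dot_herm !mul1r rmorphD rmorphM.
Qed.

Fact hs_dot_gt0 T : T != 0 -> 0 < hs_dot T T.
Proof.
have [e [be oe]] := orthonormal_basis_exists fA.
move=> T0; have [i Ti] : exists i : 'I_(\dim {:A}), T e`_i != 0.
  apply/existsP; apply: contraNT T0 => /existsPn Te0; apply/eqP/lfunP => u.
  rewrite zero_lfunE (coord_basis be (memvf u)) linear_sum big1 // => i _.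
  by rewrite linearZ /= (eqP (negbNE (Te0 i))) scaler0.
rewrite (hs_dotE _ _ be oe) mulr_gt0 ?invr_gt0 ?ltr0n ?(leq_ltn_trans _ (ltn_ord i)) //.
rewrite (bigD1 i) //= ltr_wpDr ?dnorm_gt0 // sumr_ge0 //.
Qed.

HB.instance Definition _ := @bilinear_isBilinear.Build C 'Hom(A, B) 'Hom(A, B) C
  _ _ hs_dot (hs_dot_linearl, hs_dot_linearr).
HB.instance Definition _ :=
  @isHermitianSesquilinear.Build C 'Hom(A, B) false conjC hs_dot hs_dot_herm.
HB.instance Definition _ := @isDotProduct.Build C 'Hom(A, B) hs_dot hs_dot_gt0.

End HilbertSchmidt.

Definition orthonormal_basis (A : vectType C) (f : {dot A for conjC})
    (U : {vspace A}) (X : seq A) : bool :=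
  basis_of U X && orthonormal f X.

End HermitianSpaces.

Section Representations.
Variables (C : numClosedFieldType) (gT : finGroupType).

(* Only the values on H matter. *)
Record unitary_rep (H : {group gT}) (V : vectType C) (fV : {dot V for conjC}) :=
  UnitaryRep {
    rep_fun :> gT -> 'End(V);
    rep1 : rep_fun 1%g = \1%VF;
    repM : {in H &, forall g h, rep_fun (g * h)%g = (rep_fun g \o rep_fun h)%VF};
    rep_dot : {in H, forall g u v, fV (rep_fun g u) (rep_fun g v) = fV u v}
  }.

Section Intertwiners.
Variables (H : {group gT}) (A B : vectType C).
Variables (fA : {dot A for conjC}) (fB : {dot B for conjC}).
Variables (alpha : unitary_rep H fA) (beta : unitary_rep H fB).

Definition intertwiners : {vspace 'Hom(A, B)} :=
  (\bigcap_(g in H)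
     lker (linfun (fun T : 'Hom(A, B) => (T \o alpha g) - (beta g \o T))))%VF%VS.

Lemma intertwinersP (T : 'Hom(A, B)) :
  reflect {in H, forall g, (T \o alpha g = beta g \o T)%VF}
          (T \in intertwiners).
Proof.
have lin g : linear (fun T : 'Hom(A, B) => (T \o alpha g) - (beta g \o T))%VF.
  move=> a S R; apply/lfunP=> u.
  do !rewrite ?(add_lfunE, opp_lfunE, scale_lfunE, comp_lfunE).
  by rewrite linearD linearZ /= opprD addrACA scalerBr.
pose F g : {linear 'Hom(A, B) -> 'Hom(A, B)} := HB.pack
  (fun T : 'Hom(A, B) => (T \o alpha g) - (beta g \o T))%VF
  (GRing.isSemilinear.Build _ _ _ _ _ (GRing.semilinear_linear (lin g))).
have E g : (T \in lker (linfun (F g))) = ((T \o alpha g) == (beta g \o T))%VF.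
  by rewrite memv_ker lfunE /= subr_eq0.
rewrite memvE /intertwiners; apply: (iffP subv_bigcapP) => TH g gH.
  by move: (TH g gH); rewrite -memvE (E g) => /eqP.
by rewrite -memvE (E g); apply/eqP/TH.
Qed.

End Intertwiners.

Section Induction.
Variables (K : {group gT}) (V : vectType C) (fV : {dot V for conjC}).
Variable theta : unitary_rep K fV.

(* The functions f with f (g k) = theta (k^-1) (f g) for g in G, k in K, where
   the ambient group G is the whole of gT. *)
Definition ind_space : {vspace {ffun gT -> V}} :=
  (\bigcap_(k in K) \bigcap_(g : gT)
     lker (linfun (fun f : {ffun gT -> V} =>
                     f (g * k)%g - theta (k^-1)%g (f g))))%VS.

Lemma ind_spaceP (f : {ffun gT -> V}) :
  reflect (forall g k, k \in K -> f (g * k)%g = theta (k^-1)%g (f g))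
          (f \in ind_space).
Proof.
have lin g k : linear (fun f : {ffun gT -> V} =>
    f (g * k)%g - theta (k^-1)%g (f g)).
  move=> a u v; rewrite !ffunE linearP /= scalerBr opprD addrACA.
  by [].
pose F g k : {linear {ffun gT -> V} -> V} := HB.pack
  (fun f : {ffun gT -> V} => f (g * k)%g - theta (k^-1)%g (f g))
  (GRing.isSemilinear.Build _ _ _ _ _ (GRing.semilinear_linear (lin g k))).
have E g k : (f \in lker (linfun (F g k))) =
    (f (g * k)%g == theta (k^-1)%g (f g)).
  by rewrite memv_ker lfunE /= subr_eq0.
rewrite memvE /ind_space; apply: (iffP subv_bigcapP) => [fH g k kK|fH k kK].
  move/subv_bigcapP: (fH k kK) => /(_ g isT); rewrite -memvE.
  by rewrite (E g k) => /eqP.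
apply/subv_bigcapP => g _; rewrite -memvE (E g k); apply/eqP; exact: fH.
Qed.

Definition ind : vectType C := subvs_of ind_space.

Lemma indP (f : ind) g k :
  k \in K -> vsval f (g * k)%g = theta (k^-1)%g (vsval f g).
Proof. by move=> kK; move/ind_spaceP: (subvsP f); apply. Qed.

Definition ind_dot (f1 f2 : ind) : C :=
  (#|K|%:R)^-1 * \sum_(g : gT) fV (vsval f1 g) (vsval f2 g).

Fact ind_dot_linearl f2 : linear_for *%R (ind_dot^~ f2).
Proof.
move=> a u v; rewrite /ind_dot mulrCA -mulrDr; congr (_ * _).
rewrite mulr_sumr -big_split; apply: eq_bigr => g _ /=.
by rewrite !ffunE dotDl dotZl.
Qed.

Fact ind_dot_herm f1 f2 : ind_dot f1 f2 = (-1) ^+ false * (ind_dot f2 f1)^*.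
Proof.
rewrite mul1r /ind_dot rmorphM rmorph_sum fmorphV rmorph_nat.
by congr (_ * _); apply: eq_bigr => g _; exact: dotC.
Qed.

Fact ind_dot_linearr f1 : linear_for (conjC \; *%R) (ind_dot f1).
Proof.
move=> a u v; rewrite ind_dot_herm ind_dot_linearl.
by rewrite [in RHS]ind_dot_herm [ind_dot f1 v]ind_dot_herm !mul1r rmorphD rmorphM.
Qed.

Fact ind_dot_gt0 f : f != 0 -> 0 < ind_dot f f.
Proof.
move=> f0; have [g fg] : exists g, vsval f g != 0.
  apply/existsP; apply: contraNT f0 => /existsPn f0.
  apply/eqP/val_inj/ffunP => g; rewrite [RHS]ffunE; apply/eqP.
  exact: negbNE (f0 g).
rewrite mulr_gt0 ?invr_gt0 ?ltr0n ?cardG_gt0 //.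
by rewrite (bigD1 g) //= ltr_wpDr ?dnorm_gt0 // sumr_ge0 //.
Qed.

HB.instance Definition _ := @bilinear_isBilinear.Build C ind ind C
  _ _ ind_dot (ind_dot_linearl, ind_dot_linearr).
HB.instance Definition _ :=
  @isHermitianSesquilinear.Build C ind false conjC ind_dot ind_dot_herm.
HB.instance Definition _ := @isDotProduct.Build C ind ind_dot ind_dot_gt0.

(* Left translation preserves ind_space, so the projection vsproj is only a
   coercion into the subspace type: see translateE. *)
Definition translate (g0 : gT) : 'End(ind) :=
  linfun (fun f : ind =>
    vsproj ind_space [ffun g => vsval f (g0^-1 * g)%g]).

Lemma translateE g0 f g : vsval (translate g0 f) g = vsval f (g0^-1 * g)%g.
Proof.
have mem (h : ind) : [ffun g => vsval h (g0^-1 * g)%g] \in ind_space.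
  by apply/ind_spaceP => x k kK; rewrite !ffunE mulgA indP.
have lin : linear (fun f : ind =>
    vsproj ind_space [ffun g => vsval f (g0^-1 * g)%g]).
  move=> a u v; apply: val_inj; rewrite /= !vsprojK //.
    by apply/ffunP => x; rewrite !ffunE.
  exact: (mem (a *: u + v)).
pose F : {linear ind -> ind} := HB.pack
  (fun f : ind => vsproj ind_space [ffun g => vsval f (g0^-1 * g)%g])
  (GRing.isSemilinear.Build _ _ _ _ _ (GRing.semilinear_linear lin)).
by rewrite (lfunE F) /= vsprojK // ffunE.
Qed.

Fact translate1 : translate 1%g = \1%VF.
Proof.
apply/lfunP => f; apply/val_inj/ffunP => g.
by rewrite [LHS]translateE id_lfunE invg1 mul1g.
Qed.

Fact translateM :
  {in [set: gT]%G &, forall g h,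
     translate (g * h)%g = (translate g \o translate h)%VF}.
Proof.
move=> g h _ _; apply/lfunP => f; apply/val_inj/ffunP => x.
by rewrite comp_lfunE [LHS]translateE [RHS]translateE translateE invMg mulgA.
Qed.

Fact translate_dot :
  {in [set: gT]%G, forall g f1 f2,
     ind_dot (translate g f1) (translate g f2) = ind_dot f1 f2}.
Proof.
move=> g _ f1 f2; rewrite /ind_dot; congr (_ * _).
rewrite [RHS](reindex_inj (mulgI g^-1)%g) /=.
by apply: eq_bigr => x _; rewrite !translateE.
Qed.

Definition ind_rep : unitary_rep [set: gT]%G ind_dot :=
  UnitaryRep translate1 translateM translate_dot.

Section Maps.
Variables (W : vectType C) (fW : {dot W for conjC}).
Variable sigma : unitary_rep [set: gT]%G fW.

Fact res_repM :
  {in K &, forall g h, sigma (g * h)%g = (sigma g \o sigma h)%VF}.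
Proof. by move=> g h _ _; apply: repM; rewrite inE. Qed.

Fact res_rep_dot : {in K, forall g u v, fW (sigma g u) (sigma g v) = fW u v}.
Proof. by move=> g _; apply: rep_dot; rewrite inE. Qed.

Definition res_rep : unitary_rep K fW :=
  UnitaryRep (rep1 sigma) res_repM res_rep_dot.

(* When L intertwines the K-actions, the function below already lies in
   ind_space, and vsproj does not alter it: see veeE. For other L the value is
   meaningless. *)
Definition vee (L : 'Hom(W, V)) : 'Hom(W, ind) :=
  linfun (fun w => vsproj ind_space
    [ffun g => (sqrtC #|[set: gT] : K|%g%:R)^-1 *: L (sigma (g^-1)%g w)]).

Lemma veeE (L : 'Hom(W, V)) w g : L \in intertwiners res_rep theta ->
  vsval (vee L w) g = (sqrtC #|[set: gT] : K|%g%:R)^-1 *: L (sigma (g^-1)%g w).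
Proof.
move=> /intertwinersP LK.
pose v w : {ffun gT -> V} :=
  [ffun g => (sqrtC #|[set: gT] : K|%g%:R)^-1 *: L (sigma (g^-1)%g w)].
have mem u : v u \in ind_space.
  apply/ind_spaceP => x k kK; rewrite !ffunE linearZ /=; congr (_ *: _).
  rewrite -[RHS]comp_lfunE -LK ?groupV // comp_lfunE invMg /=.
  by rewrite repM ?inE // comp_lfunE.
have lin : linear (fun w => vsproj ind_space (v w)).
  move=> a x y; apply: val_inj; rewrite /= !vsprojK //.
  by apply/ffunP => z; rewrite !ffunE !linearP.
pose F : {linear W -> ind} := HB.pack (fun w => vsproj ind_space (v w))
  (GRing.isSemilinear.Build _ _ _ _ _ (GRing.semilinear_linear lin)).
by rewrite (lfunE F) /= vsprojK // ffunE.
Qed.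

Definition diamond (L : 'Hom(V, W)) : 'Hom(ind, W) :=
  linfun (fun f : ind =>
    (sqrtC (#|[set: gT]| * #|K|)%:R)^-1 *:
      \sum_(g : gT) sigma g (L (vsval f g))).

Lemma diamondE (L : 'Hom(V, W)) f :
  diamond L f = (sqrtC (#|[set: gT]| * #|K|)%:R)^-1 *:
    \sum_(g : gT) sigma g (L (vsval f g)).
Proof.
have lin : linear (fun f : ind => (sqrtC (#|[set: gT]| * #|K|)%:R)^-1 *:
      \sum_(g : gT) sigma g (L (vsval f g))).
  move=> a x y; rewrite scalerA mulrC -scalerA -scalerDr; congr (_ *: _).
  rewrite scaler_sumr -big_split; apply: eq_bigr => g _ /=.
  by rewrite !ffunE !linearP.
pose F : {linear ind -> W} := HB.pack
  (fun f : ind => (sqrtC (#|[set: gT]| * #|K|)%:R)^-1 *: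
      \sum_(g : gT) sigma g (L (vsval f g)))
  (GRing.isSemilinear.Build _ _ _ _ _ (GRing.semilinear_linear lin)).
by rewrite (lfunE F).
Qed.

End Maps.
End Induction.
End Representations.

Arguments ind_dot {C gT K V fV} theta f1 f2.
Arguments vee {C gT K V fV} theta {W fW} sigma L.
Arguments diamond {C gT K V fV} theta {W fW} sigma L.

(* Main.v *)
Require Import Defs.
From HB Require Import structures.
From mathcomp Require Import all_boot all_order all_algebra all_fingroup.
From mathcomp Require Import complex reals.

Set Implicit Arguments.
Unset Strict Implicit.
Unset Printing Implicit Defensive.

Import Order.TTheory GRing.Theory Num.Theory Num.Def.
Local Open Scope ring_scope.

(* With normalized Hilbert-Schmidt products, vee is an isometry of Hom_K(W, V)
   onto Hom_G(W, Ind V) (Frobenius reciprocity), and taking adjoints of maps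
   A -> B is an antilinear isometry once rescaled by sqrt(dim B / dim A). Since
   diamond L is the adjoint of vee (L^* ) and dim Ind V = |G : K| dim V, the three
   families (2), (3), (4) are images of the L_i under linear or antilinear
   isometries. All four Hom spaces thus have dimension m, so that a family of m
   vectors in one of them is an orthonormal basis if and only if it is
   orthonormal, and orthonormality is transported by these isometries. *)

(** * Orthonormal families under semi-isometries *)

Section OrthonormalFamilies.
Variable C : numClosedFieldType.

Lemma orthonormal_cons (A : vectType C) (f : {dot A for conjC}) x s :
  orthonormal f (x :: s) =
    [&& f x x == 1, all (fun y => f x y == 0) s & orthonormal f s].
Proof.
rewrite -cat1s orthonormal_cat {1}/orthonormal /orthogonal /=.
by rewrite !andbT; congr andb; exact: andbC.
Qed.

(** Orthonormal vectors are free, and [\dim U] free vectors of [U] span it. *)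
Lemma orthonormal_basisE (A : vectType C) (f : {dot A for conjC})
    (U : {vspace A}) s :
    {subset s <= U} -> size s = \dim U ->
  orthonormal_basis f U s = orthonormal f s.
Proof.
move=> sU szs; rewrite /orthonormal_basis andb_idl // => os.
by rewrite basisEfree (orthonormal_free os) szs leqnn andbT; apply/span_subvP.
Qed.

(** [orthonormalP] compares vectors, not indices: a repeated vector would give 1 = 0, so distinct
    indices carry distinct vectors. *)
Lemma orthonormal_tuple (A : vectType C) (f : {dot A for conjC}) n
    (e : n.-tuple A) :
  (forall i j : 'I_n, f e`_i e`_j = (i == j)%:R) -> orthonormal f e.
Proof.
move=> oe; apply/orthonormalP; split; last first.
  move=> _ _ /tnthP[i ->] /tnthP[j ->]; rewrite !(tnth_nth 0) oe.
  have [->|ij] := eqVneq i j; first by rewrite eqxx.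
  case: eqP => // eij; have := oe i j; rewrite eij oe eqxx (negPf ij).
  by move=> /eqP; rewrite oner_eq0.
apply/(uniqP 0) => i j; rewrite !inE size_tuple => li lj eij; apply/eqP.
have := oe (Ordinal li) (Ordinal lj); rewrite /= -eij (oe (Ordinal li) (Ordinal li)).
by rewrite eqxx -val_eqE /=; case: (i == j) => // /eqP; rewrite oner_eq0.
Qed.

Section SemiIsometry.
Variables (A B : vectType C) (fA : {dot A for conjC}) (fB : {dot B for conjC}).
(* c is the identity or the conjugation, according to whether phi is linear or
   antilinear. *)
Variables (c : {rmorphism C -> C}) (phi : A -> B) (U : {vspace A}).
Hypothesis phi_iso : {in U &, forall x y, fB (phi x) (phi y) = c (fA x y)}.

(** A field morphism [c] is injective and fixes 0 and 1, the only values tested by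
    orthonormality. *)
Lemma orthonormal_map s :
  {subset s <= U} -> orthonormal fB (map phi s) = orthonormal fA s.
Proof.
elim: s => // x s IH sU.
have xU : x \in U by apply: sU; rewrite mem_head.
have {}sU : {subset s <= U} by move=> y ys; apply: sU; rewrite inE ys orbT.
rewrite map_cons !orthonormal_cons (IH sU) phi_iso // fmorph_eq1.
rewrite all_map; congr [&& _, _ & _]; apply: eq_in_all => y ys /=.
by rewrite phi_iso ?fmorph_eq0 //; apply: sU.
Qed.

(** An orthonormal basis of [U] is sent to an orthonormal, hence free, family of [U']. *)
Lemma dim_semi_isometry (U' : {vspace B}) :
  {in U, forall x, phi x \in U'} -> (\dim U <= \dim U')%N.
Proof.
move=> phiU; have [s [sU os]] := Gram_Schmidt fA (vbasis U).
rewrite (span_basis (vbasisP U)) in sU.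
have sinU : {subset s <= U} by move=> x xs; rewrite -sU memv_span.
rewrite -sU (eqP (orthonormal_free os)) -(size_map phi).
have ophi : orthonormal fB (map phi s) by rewrite orthonormal_map.
rewrite -(eqP (orthonormal_free ophi)); apply/dimvS/span_subvP.
by move=> _ /mapP[x xs ->]; apply/phiU/sinU.
Qed.

End SemiIsometry.
End OrthonormalFamilies.

(** * Hilbert-Schmidt products and adjoints *)

Section HilbertSchmidtAdjoint.
Variable C : numClosedFieldType.

(* Also valid when \dim A = 0, where hs_dot vanishes because 0^-1 = 0. *)
Lemma dim_hs_dotE (A B : vectType C) (fA : {dot A for conjC})
    (fB : {dot B for conjC}) (e : (\dim {:A}).-tuple A) (S T : 'Hom(A, B)) :
    basis_of {:A} e ->
    (forall i j : 'I_(\dim {:A}), fA e`_i e`_j = (i == j)%:R) ->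
  (\dim {:A})%:R * hs_dot fA fB S T = \sum_(i < \dim {:A}) fB (S e`_i) (T e`_i).
Proof.
move=> be oe; rewrite (hs_dotE _ _ _ be oe) mulrA.
have [d0|d0] := eqVneq (\dim {:A}) 0%N.
  have -> : (\dim {:A})%:R = 0 :> C by rewrite d0.
  by rewrite !mul0r big1 // => i; have := ltn_ord i; rewrite [X in (_ < X)%N]d0.
by rewrite mulfV ?mul1r // pnatr_eq0.
Qed.

Lemma parseval (A : vectType C) (f : {dot A for conjC})
    (e : (\dim {:A}).-tuple A) u v :
    basis_of {:A} e ->
    (forall i j : 'I_(\dim {:A}), f e`_i e`_j = (i == j)%:R) ->
  f u v = \sum_(i < \dim {:A}) f u e`_i * f e`_i v.
Proof.
move=> be oe; rewrite {1}(coord_basis be (memvf u)) dot_suml.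
apply: eq_bigr => i _; rewrite dotZl; congr (_ * _).
rewrite [in RHS](coord_basis be (memvf u)) dot_suml (bigD1 i) //= dotZl oe eqxx.
by rewrite mulr1 big1 ?addr0 // => j ji; rewrite dotZl oe (negPf ji) mulr0.
Qed.

(** Settles the degenerate dimensions, where the scaling ratios cannot be inverted. *)
Lemma hs_dot_eq0 (A B : vectType C) (fA : {dot A for conjC})
    (fB : {dot B for conjC}) (S T : 'Hom(A, B)) :
  (\dim {:A} == 0) || (\dim {:B} == 0) -> hs_dot fA fB S T = 0.
Proof.
have [e [be oe]] := orthonormal_basis_exists fA.
rewrite (hs_dotE _ _ _ be oe) => /orP[/eqP A0|].
  by have -> : (\dim {:A})%:R^-1 = 0 :> C; rewrite ?mul0r // A0 invr0.
rewrite dimv_eq0 => /eqP B0; rewrite big1 ?mulr0 // => i _.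
have /eqP-> : S e`_i == 0 by rewrite -memv0 -B0 memvf.
by rewrite linear0l.
Qed.

Section Adjoint.
Variables (A B : vectType C) (fA : {dot A for conjC}) (fB : {dot B for conjC}).

Lemma adjointPr (T : 'Hom(A, B)) a b : fB b (T a) = fA (adjoint fA fB T b) a.
Proof. by rewrite dotC (adjointP fA) -dotC. Qed.

Lemma adjoint_unique (T : 'Hom(A, B)) (S : 'Hom(B, A)) :
  (forall a b, fB (T a) b = fA a (S b)) -> S = adjoint fA fB T.
Proof.
move=> TS; apply/lfunP => b; apply: (dot_injr (f := fA)) => a.
by rewrite -TS (adjointP fA).
Qed.

(** In orthonormal bases [e] and [b], both sides are the double sum of
    [fB (T e_i) b_j * fB b_j (S e_i)]. *)
Lemma hs_dot_adjoint (S T : 'Hom(A, B)) :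
  (\dim {:B})%:R * hs_dot fB fA (adjoint fA fB S) (adjoint fA fB T) =
    (\dim {:A})%:R * hs_dot fA fB T S.
Proof.
have [e [be oe]] := orthonormal_basis_exists fA.
have [b [bb ob]] := orthonormal_basis_exists fB.
rewrite (dim_hs_dotE _ _ _ be oe) (dim_hs_dotE _ _ _ bb ob).
under eq_bigr => j _ do rewrite (parseval _ _ be oe).
rewrite exchange_big; apply: eq_bigr => i _.
rewrite (parseval _ _ bb ob); apply: eq_bigr => j _.
by rewrite -adjointP -adjointPr mulrC.
Qed.

(** The factor [r ^+ 2] corrects the change of normalization from [\dim A] to [\dim B]. *)
Lemma hs_dot_scaled_adjoint (S T : 'Hom(A, B)) :
  let r := sqrtC ((\dim {:B})%:R / (\dim {:A})%:R) in
  hs_dot fB fA (r *: adjoint fA fB S) (r *: adjoint fA fB T) =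
    (hs_dot fA fB S T)^*.
Proof.
move=> r; rewrite -dotC dotZl dotZr /= geC0_conj ?sqrtC_ge0 ?divr_ge0 ?ler0n //.
rewrite mulrA -expr2 sqrtCK.
have [AB0|] := boolP ((\dim {:A} == 0) || (\dim {:B} == 0)).
  by rewrite [RHS]hs_dot_eq0 // hs_dot_eq0 ?mulr0 1?orbC.
rewrite negb_or => /andP[A0 B0].
by rewrite mulrAC hs_dot_adjoint mulrC mulKf // pnatr_eq0.
Qed.

End Adjoint.

Lemma adjointK (A B : vectType C) (fA : {dot A for conjC})
    (fB : {dot B for conjC}) (T : 'Hom(A, B)) :
  adjoint fB fA (adjoint fA fB T) = T.
Proof. by apply/esym/adjoint_unique => b a; rewrite (adjointPr fA). Qed.

(** [u] maps an orthonormal basis to another one, and the product can be computed in either. *)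
Lemma hs_dot_unitary (A B : vectType C) (fA : {dot A for conjC})
    (fB : {dot B for conjC}) (u : 'End(A)) (S T : 'Hom(A, B)) :
    (forall x y, fA (u x) (u y) = fA x y) ->
  hs_dot fA fB (S \o u)%VF (T \o u)%VF = hs_dot fA fB S T.
Proof.
move=> uu; have [e [be oe]] := orthonormal_basis_exists fA.
have un i : (i < \dim {:A})%N -> (map_tuple u e)`_i = u e`_i.
  by move=> ?; rewrite (nth_map 0) ?size_tuple.
have oue (i j : 'I_(\dim {:A})) :
    fA (map_tuple u e)`_i (map_tuple u e)`_j = (i == j)%:R.
  by rewrite !un // uu oe.
have bue : basis_of {:A} (map_tuple u e).
  rewrite basisEfree subvf /= size_map size_tuple leqnn andbT.
  exact: (orthonormal_free (orthonormal_tuple oue)).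
rewrite (hs_dotE _ _ _ be oe) (hs_dotE _ _ _ bue oue); congr (_ * _).
by apply: eq_bigr => i _; rewrite !comp_lfunE un.
Qed.

End HilbertSchmidtAdjoint.

(** * Unitary representations and adjoints of intertwiners *)

Section UnitaryRep.
Variables (C : numClosedFieldType) (gT : finGroupType) (H : {group gT}).

Lemma repKV (V : vectType C) (fV : {dot V for conjC}) (rho : unitary_rep H fV) g v :
  g \in H -> rho g (rho g^-1%g v) = v.
Proof.
by move=> gH; rewrite -comp_lfunE -repM ?groupV // mulgV rep1 id_lfunE.
Qed.

Lemma rep_adjoint (V : vectType C) (fV : {dot V for conjC})
    (rho : unitary_rep H fV) g u v :
  g \in H -> fV (rho g^-1%g u) v = fV u (rho g v).
Proof. by move=> gH; rewrite -(rep_dot rho gH) repKV. Qed.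

Variables (A B : vectType C) (fA : {dot A for conjC}) (fB : {dot B for conjC}).
Variables (alpha : unitary_rep H fA) (beta : unitary_rep H fB).

(** By unitarity the adjoint of [alpha g^-1] is [alpha g], so the relation for [T] at [g^-1] has as
    adjoint the relation wanted at [g]. *)
Lemma adjoint_intertwiner (T : 'Hom(A, B)) :
  T \in intertwiners alpha beta -> adjoint fA fB T \in intertwiners beta alpha.
Proof.
move=> /intertwinersP Tab; apply/intertwinersP => g gH; apply/lfunP => b.
apply: (dot_injr (f := fA)) => a.
rewrite !comp_lfunE -(adjointP fA fB) -(rep_adjoint beta) // -(rep_adjoint alpha) //.
by rewrite -(adjointP fA fB) -!comp_lfunE Tab ?groupV.
Qed.

End UnitaryRep.

Lemma dim_intertwiners_sym (C : numClosedFieldType) (gT : finGroupType)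
    (H : {group gT}) (A B : vectType C) (fA : {dot A for conjC})
    (fB : {dot B for conjC}) (alpha : unitary_rep H fA)
    (beta : unitary_rep H fB) :
  \dim (intertwiners alpha beta) = \dim (intertwiners beta alpha).
Proof.
apply/eqP; rewrite eqn_leq; apply/andP; split.
  apply: (dim_semi_isometry (c := conjC) (in2W (hs_dot_scaled_adjoint fA fB))).
  by move=> T /adjoint_intertwiner TH; rewrite memvZ.
apply: (dim_semi_isometry (c := conjC) (in2W (hs_dot_scaled_adjoint fB fA))).
by move=> T /adjoint_intertwiner TH; rewrite memvZ.
Qed.

(** * The induced space: evaluation at 1 and dimension *)

Section Induction.
Variables (C : numClosedFieldType) (gT : finGroupType) (K : {group gT}).
Variables (V : vectType C) (fV : {dot V for conjC}) (theta : unitary_rep K fV).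

Lemma card_index : #|gT|%:R = #|K|%:R * #|[set: gT] : K|%g%:R :> C.
Proof. by rewrite -natrM (Lagrange (subsetT K)) cardsT. Qed.

Lemma cardK_neq0 : #|K|%:R != 0 :> C.
Proof. by rewrite pnatr_eq0 -lt0n cardG_gt0. Qed.

Lemma index_neq0 : #|[set: gT] : K|%g%:R != 0 :> C.
Proof. by rewrite pnatr_eq0 -lt0n indexg_gt0. Qed.

(** The counit of Frobenius reciprocity; its values on the translates of [f] recover [f]. *)
Definition ind_eval1 : 'Hom(ind theta, V) :=
  linfun (fun f : ind theta => vsval f 1%g).

Lemma ind_eval1E f : ind_eval1 f = vsval f 1%g.
Proof.
have lin : linear (fun f : ind theta => vsval f 1%g).
  by move=> a x y; rewrite !ffunE.
pose F : {linear ind theta -> V} := HB.pack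
  (fun f : ind theta => vsval f 1%g)
  (GRing.isSemilinear.Build _ _ _ _ _ (GRing.semilinear_linear lin)).
by rewrite (lfunE F).
Qed.

(* The adjoint of the evaluation at 1 sends v to the function supported by K
   with value v at 1. *)
Lemma ind_eval1_adjoint v : ind_eval1 (adjoint (ind_dot theta) fV ind_eval1 v) = v.
Proof.
pose d : {ffun gT -> V} := [ffun k => if k \in K then theta k^-1%g v else 0].
have dI : d \in ind_space theta.
  apply/ind_spaceP => g k kK; rewrite !ffunE groupMr //.
  case: ifP => gK; last by rewrite linear0.
  by rewrite invMg repM ?groupV // comp_lfunE.
have -> : adjoint (ind_dot theta) fV ind_eval1 v = vsproj (ind_space theta) d.
  apply: (dot_injr (f := ind_dot theta)) => f.
  rewrite -(adjointP (ind_dot theta) fV) ind_eval1E /= /ind_dot vsprojK //.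
  (* Off [K] the terms vanish; on [K], covariance of [f] and unitarity of [theta] make each of the
     [#|K|] terms equal to [fV (vsval f 1%g) v]. *)
  rewrite (bigID (mem K)) /= addrC big1 => [|g /negPf gK]; last first.
    by rewrite ffunE gK linear0r.
  rewrite add0r (eq_bigr (fun _ => fV (vsval f 1%g) v)) => [|k kK].
    by rewrite sumr_const -[X in _ * X]mulr_natl mulKf ?cardK_neq0.
  by rewrite ffunE kK -{1}[k]mul1g indP // (rep_dot theta) ?groupV //.
by rewrite ind_eval1E vsprojK // ffunE group1 invg1 rep1 id_lfunE.
Qed.

Lemma ind_eval1_translate g f :
  ind_eval1 (ind_rep theta g^-1%g f) = vsval f g.
Proof. by rewrite ind_eval1E [LHS]translateE invgK mulg1. Qed.

(* Compute the sum of the squared norms of an orthonormal basis of the induced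
   space pointwise on the group, by means of ind_eval1_adjoint. *)
Lemma dim_ind :
  (\dim {:ind theta})%:R = #|[set: gT] : K|%g%:R * (\dim {:V})%:R :> C.
Proof.
have [e [be oe]] := orthonormal_basis_exists (ind_dot theta).
have [b [bb ob]] := orthonormal_basis_exists fV.
(* Translation by [g^-1] is unitary, so the sum equals the one at 1, the unnormalized squared norm
   of [ind_eval1]. Its adjoint is an isometric section, which gives one unit term per vector of
   [b]. *)
have evV g : \sum_(i < \dim {:ind theta}) fV (vsval e`_i g) (vsval e`_i g) =
    (\dim {:V})%:R.
  under eq_bigr => i _ do rewrite -ind_eval1_translate -comp_lfunE.
  rewrite -(dim_hs_dotE _ _ _ be oe) hs_dot_unitary; last first.
    by move=> x y; rewrite rep_dot ?inE.
  rewrite -hs_dot_adjoint (dim_hs_dotE _ _ _ bb ob).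
  under eq_bigr => j _ do
    rewrite -(adjointP (ind_dot theta) fV) ind_eval1_adjoint ob eqxx.
  by rewrite sumr_const card_ord.
have -> : (\dim {:ind theta})%:R =
    \sum_(i < \dim {:ind theta}) ind_dot theta e`_i e`_i.
  under eq_bigr => i _ do rewrite oe eqxx.
  by rewrite sumr_const card_ord.
rewrite -mulr_sumr exchange_big /= (eq_bigr _ (fun g _ => evV g)).
rewrite sumr_const -[X in _ * X]mulr_natl card_index mulrA mulKf //.
exact: cardK_neq0.
Qed.

(** * Frobenius reciprocity; the maps [vee] and [diamond] *)

Section Maps.
Variables (W : vectType C) (fW : {dot W for conjC}).
Variable sigma : unitary_rep [set: gT]%G fW.

Local Notation HomK_WV := (intertwiners (res_rep K sigma) theta).
Local Notation HomK_VW := (intertwiners theta (res_rep K sigma)).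

Lemma vee_intertwiner (L : 'Hom(W, V)) :
  L \in HomK_WV -> vee theta sigma L \in intertwiners sigma (ind_rep theta).
Proof.
move=> LK; apply/intertwinersP => g _; apply/lfunP => w.
apply/val_inj/ffunP => x; rewrite !comp_lfunE [RHS]translateE !veeE //.
by rewrite invMg invgK repM ?inE // comp_lfunE.
Qed.

(** By unitarity of [sigma g^-1], each [g] contributes the product of [S] and [T] divided by the
    index; summing over the group and dividing by [#|K|] leaves exactly one copy. *)
Lemma vee_isometry :
  {in HomK_WV &, forall S T, hs_dot fW (ind_dot theta)
     (vee theta sigma S) (vee theta sigma T) = hs_dot fW fV S T}.
Proof.
move=> S T SK TK; have [e [be oe]] := orthonormal_basis_exists fW.
rewrite (hs_dotE _ _ _ be oe) -mulr_sumr exchange_big /=.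
rewrite mulrCA mulr_sumr.
have inner g : (\dim {:W})%:R^-1 * \sum_(i < \dim {:W})
      fV (vsval (vee theta sigma S e`_i) g) (vsval (vee theta sigma T e`_i) g) =
    #|[set: gT] : K|%g%:R^-1 * hs_dot fW fV S T.
  rewrite -(hs_dot_unitary fV (u := sigma g^-1%g)); last first.
    by move=> x y; rewrite rep_dot ?inE.
  rewrite (hs_dotE _ _ _ be oe) [RHS]mulrCA; congr (_ * _).
  rewrite mulr_sumr; apply: eq_bigr => i _; rewrite !veeE // dotZl dotZr mulrA.
  rewrite !comp_lfunE geC0_conj ?invr_ge0 ?sqrtC_ge0 ?ler0n //.
  by rewrite -invfM -expr2 sqrtCK.
rewrite (eq_bigr _ (fun g _ => inner g)) sumr_const -[X in _ * X]mulr_natl.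
rewrite card_index !mulrA mulVf ?cardK_neq0 // mul1r mulfV ?mul1r //.
exact: index_neq0.
Qed.

(** The inverse of [vee] is evaluation at 1, with a factor undoing the normalization of [vee]. *)
Lemma vee_surj (T : 'Hom(W, ind theta)) :
    T \in intertwiners sigma (ind_rep theta) ->
  let S := sqrtC #|[set: gT] : K|%g%:R *: (ind_eval1 \o T)%VF in
  S \in HomK_WV /\ vee theta sigma S = T.
Proof.
move=> /intertwinersP TG S.
(* The intertwining relation at [g^-1] moves the value at [g] to the value at 1. *)
have TE g w : vsval (T (sigma g^-1%g w)) 1%g = vsval (T w) g.
  have /lfunP/(_ w) := TG g^-1%g (in_setT _); rewrite !comp_lfunE => ->.
  by rewrite -ind_eval1E ind_eval1_translate.
have SK : S \in HomK_WV.
  rewrite memvZ //; apply/intertwinersP => k kK; apply/lfunP => w.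
  rewrite !comp_lfunE !ind_eval1E /= -{1}(invgK k) TE -(mul1g k^-1%g).
  by rewrite indP ?groupV // invgK.
split=> //; apply/lfunP => w; apply/val_inj/ffunP => g; rewrite veeE //.
rewrite scale_lfunE scalerA mulVf ?sqrtC_eq0 ?index_neq0 // scale1r.
by rewrite comp_lfunE ind_eval1E TE.
Qed.

Lemma dim_Frobenius :
  \dim (intertwiners sigma (ind_rep theta)) = \dim HomK_WV.
Proof.
apply/eqP; rewrite eqn_leq; apply/andP; split; last first.
  exact: (dim_semi_isometry (c := idfun) vee_isometry vee_intertwiner).
pose phi (T : 'Hom(W, ind theta)) : 'Hom(W, V) :=
  sqrtC #|[set: gT] : K|%g%:R *: (ind_eval1 \o T)%VF.
apply: (@dim_semi_isometry _ _ _ (hs_dot fW (ind_dot theta)) (hs_dot fW fV)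
  idfun phi).
  move=> S T /vee_surj[SK SE] /vee_surj[TK TE] /=.
  by rewrite -vee_isometry // SE TE.
by move=> T /vee_surj[].
Qed.

Lemma diamond_vee (L : 'Hom(V, W)) : L \in HomK_VW ->
  diamond theta sigma L =
    adjoint fW (ind_dot theta) (vee theta sigma (adjoint fV fW L)).
Proof.
move=> LK; apply: adjoint_unique => w f /=.
have LK' := adjoint_intertwiner LK.
rewrite diamondE dotZr geC0_conj ?invr_ge0 ?sqrtC_ge0 ?ler0n // dot_sumr.
rewrite /ind_dot !mulr_sumr; apply: eq_bigr => g _.
rewrite veeE // dotZl -(adjointPr fV) mulrA rep_adjoint ?inE //; congr (_ * _).
(* The two normalizations agree because the square root of [#|gT| * #|K|] is [#|K|] times that of
   the index. *)
rewrite cardsT natrM card_index mulrAC -expr2 sqrtCM ?qualifE /= ?exprn_ge0 ?ler0n //.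
by rewrite sqrCK ?ler0n // invfM.
Qed.

Lemma diamond_intertwiner (L : 'Hom(V, W)) : L \in HomK_VW ->
  diamond theta sigma L \in intertwiners (ind_rep theta) sigma.
Proof.
move=> LK; rewrite diamond_vee //.
apply: (adjoint_intertwiner (fB := ind_dot theta)).
exact: vee_intertwiner (adjoint_intertwiner LK).
Qed.

(** By [diamond_vee] two adjoints are taken: their conjugations cancel, the two factors [\dim W]
    cancel, and [dim_ind] leaves the index, absorbed by [s ^+ 2]. *)
Lemma scaled_diamond_isometry :
  let s := sqrtC #|[set: gT] : K|%g%:R in
  {in HomK_VW &, forall S T, hs_dot (ind_dot theta) fW
     (s *: diamond theta sigma S) (s *: diamond theta sigma T) =
   hs_dot fV fW S T}.
Proof.
move=> s S T SK TK; rewrite dotZl dotZr /= geC0_conj ?sqrtC_ge0 ?ler0n //.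
rewrite mulrA -expr2 sqrtCK !diamond_vee //.
(* If [V] or [W] is zero, both products vanish; [dim_ind] passes from [V] to the induced space. *)
have [VW0|] := boolP ((\dim {:V} == 0) || (\dim {:W} == 0)).
  have IW0 : (\dim {:ind theta} == 0) || (\dim {:W} == 0).
    rewrite -(eqr_nat C) dim_ind mulf_eq0 (negPf index_neq0) /=.
    by rewrite pnatr_eq0.
  by rewrite [RHS]hs_dot_eq0 // hs_dot_eq0 ?mulr0.
rewrite negb_or => /andP[V0 W0].
have V0' : (\dim {:V})%:R != 0 :> C by rewrite pnatr_eq0.
apply: (mulfI V0').
rewrite mulrA [_ * #|_ : _|%g%:R]mulrC -dim_ind.
rewrite [LHS]hs_dot_adjoint vee_isometry ?adjoint_intertwiner //.
by rewrite [LHS]hs_dot_adjoint.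
Qed.

Lemma scaled_vee_adjoint_isometry :
  let r := sqrtC ((\dim {:W})%:R / (\dim {:V})%:R) in
  {in HomK_VW &, forall S T, hs_dot fW (ind_dot theta)
     (r *: vee theta sigma (adjoint fV fW S))
     (r *: vee theta sigma (adjoint fV fW T)) = (hs_dot fV fW S T)^*}.
Proof.
move=> r S T SK TK; rewrite -hs_dot_scaled_adjoint !dotZl !dotZr /=.
by rewrite vee_isometry ?adjoint_intertwiner.
Qed.

End Maps.
End Induction.

(** * The four orthonormal bases *)

Theorem corollary3p4 (R : realType) (gT : finGroupType) (K : {group gT})
    (W V : vectType R[i]) (fW : {dot W for conjC}) (fV : {dot V for conjC})
    (sigma : unitary_rep [set: gT]%G fW) (theta : unitary_rep K fV)
    (m : nat) (hm : m = \dim (intertwiners sigma (ind_rep theta)))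
    (L : m.-tuple 'Hom(V, W))
    (hL : forall i : 'I_m, tnth L i \in intertwiners theta (res_rep K sigma)) :
  let index : R[i] := #|[set: gT] : K|%g%:R in
  let ratio : R[i] := (\dim {:W})%:R / (\dim {:V})%:R in
  [<->
    orthonormal_basis (hs_dot fV fW)
      (intertwiners theta (res_rep K sigma)) L;
    orthonormal_basis (hs_dot (ind_dot theta) fW)
      (intertwiners (ind_rep theta) sigma)
      [seq sqrtC index *: diamond theta sigma T | T <- L];
    orthonormal_basis (hs_dot fW fV)
      (intertwiners (res_rep K sigma) theta)
      [seq sqrtC ratio *: adjoint fV fW T | T <- L];
    orthonormal_basis (hs_dot fW (ind_dot theta))
      (intertwiners sigma (ind_rep theta))
      [seq sqrtC ratio *: vee theta sigma (adjoint fV fW T) | T <- L]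
  ].
Proof.

move=> index ratio.
have LU : {subset L <= intertwiners theta (res_rep K sigma)}.
  by move=> _ /tnthP[i ->].
(* Frobenius reciprocity and the two adjoint symmetries link all four dimensions to [m]. *)
have dimWI := dim_Frobenius theta sigma.
have dimVW := dim_intertwiners_sym theta (res_rep K sigma).
have dimIW := dim_intertwiners_sym (ind_rep theta) sigma.
have subU (A B : vectType R[i]) (U : {vspace 'Hom(A, B)}) F :
    {in intertwiners theta (res_rep K sigma), forall T, F T \in U} ->
    {subset [seq F T | T <- L] <= U}.
  by move=> FU _ /mapP[T TL ->]; apply/FU/LU.
have E1 : orthonormal_basis (hs_dot fV fW)
    (intertwiners theta (res_rep K sigma)) L = orthonormal (hs_dot fV fW) L.
  by rewrite orthonormal_basisE // size_tuple hm dimWI dimVW.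
have E2 : orthonormal_basis (hs_dot (ind_dot theta) fW)
    (intertwiners (ind_rep theta) sigma)
    [seq sqrtC index *: diamond theta sigma T | T <- L] =
    orthonormal (hs_dot fV fW) L.
  rewrite orthonormal_basisE ?size_map ?size_tuple ?dimIW //; last first.
    by apply: subU => T TK; rewrite memvZ // diamond_intertwiner.
  exact: (orthonormal_map (c := idfun) (scaled_diamond_isometry (sigma := sigma))).
have E3 : orthonormal_basis (hs_dot fW fV)
    (intertwiners (res_rep K sigma) theta)
    [seq sqrtC ratio *: adjoint fV fW T | T <- L] =
    orthonormal (hs_dot fV fW) L.
  rewrite orthonormal_basisE ?size_map ?size_tuple -?dimWI //; last first.
    by apply: subU => T TK; rewrite memvZ // adjoint_intertwiner.
  exact: (orthonormal_map (c := conjC) (in2W (hs_dot_scaled_adjoint fV fW)) LU).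
have E4 : orthonormal_basis (hs_dot fW (ind_dot theta))
    (intertwiners sigma (ind_rep theta))
    [seq sqrtC ratio *: vee theta sigma (adjoint fV fW T) | T <- L] =
    orthonormal (hs_dot fV fW) L.
  rewrite orthonormal_basisE ?size_map ?size_tuple //; last first.
    by apply: subU => T TK; rewrite memvZ // vee_intertwiner // adjoint_intertwiner.
  exact: (orthonormal_map (c := conjC) (scaled_vee_adjoint_isometry (sigma := sigma))).
by rewrite E1 E2 E3 E4; tfae.
Qed.
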